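(* Let $m,n$ be positive integers and let $\mathcal{A}$ be a real skew centrosymmetric tensor of order $m$ and dimension $n$. If $\mathcal{A}$ has a nonzero H-eigenvalue $\lambda$ with an H-eigenvector $x$, then $Jx$ is also an H-eigenvector of $\mathcal{A}$, corresponding to the H-eigenvalue $-\lambda$.
   Context: A real tensor of order $m$ and dimension $n$ is an array $\mathcal{A}=(a_{i_1\cdots i_m})$ of reals with $i_1,\dots,i_m\in[n]=\{1,\dots,n\}$. It is skew centrosymmetric if $a_{i_1\cdots i_m}=-a_{n-i_1+1,\dots,n-i_m+1}$ for all indices. For $x\in\mathbb{R}^n$, $\mathcal{A}x^{m-1}\in\mathbb{R}^n$ has $i$-th component $\sum_{i_2,\dots,i_m=1}^n a_{ii_2\cdots i_m}x_{i_2}\cdots x_{i_m}$, and $x^{[m-1]}=(x_1^{m-1},\dots,x_n^{m-1})$. If $\lambda\in\mathbb{R}$ and $x\in\mathbb{R}^n\setminus\{0\}$ satisfy $\mathcal{A}x^{m-1}=\lambda x^{[m-1]}$, then $\lambda$ is an H-eigenvalue of $\mathcal{A}$ and $x$ an H-eigenvector corresponding to $\lambda$. $J$ is the $n\times n$ matrix with $J_{ij}=\delta_{i,\,n-j+1}$, so $(Jx)_i=x_{n-i+1}$. *)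

(* Defs.v *)
From HB Require Import structures.
From mathcomp Require Import all_boot all_order all_algebra.
From mathcomp Require Import reals.

Set Implicit Arguments.
Unset Strict Implicit.
Unset Printing Implicit Defensive.

Import Order.TTheory GRing.Theory Num.Theory.
Local Open Scope ring_scope.

(* Indices are 0-based: [n] is 'I_n, and i |-> n - i + 1 on [n]
   becomes [rev_ord : 'I_n -> 'I_n], whose value is n - i.+1. *)

Definition tensor (R : Type) (m n : nat) := {ffun m.-tuple 'I_n -> R}.

Definition skew_centrosymmetric (R : realType) (m n : nat)
    (A : tensor R m n) : Prop :=
  forall t : m.-tuple 'I_n, A t = - A [tuple of map (@rev_ord n) t].

(* A x^{m-1} for A of positive order; the order is m.+1, so that the
   exponent "order minus one" is m. *)
Definition tensor_app (R : realType) (m n : nat)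
    (A : tensor R m.+1 n) (x : 'cV[R]_n) : 'cV[R]_n :=
  \col_i \sum_(t : m.-tuple 'I_n)
    A [tuple of i :: t] * \prod_(k < m) x (tnth t k) 0.

(* x^{[k]}; for k = 0 every entry is 1, including 0 ^+ 0. *)
Definition vec_pow (R : realType) (n : nat) (x : 'cV[R]_n) (k : nat) :
    'cV[R]_n :=
  \col_i x i 0 ^+ k.

(* lambda is an H-eigenvalue of A and x an H-eigenvector corresponding to it. *)
Definition H_eigenpair (R : realType) (m n : nat)
    (A : tensor R m.+1 n) (lambda : R) (x : 'cV[R]_n) : Prop :=
  x != 0 /\ tensor_app A x = lambda *: vec_pow x m.

Definition exchange_mx (R : realType) (n : nat) : 'M[R]_n :=
  \matrix_(i, j) (i == rev_ord j)%:R.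

(* Main.v *)
(* Reindexing the sum defining [A (Jx)^(m-1)] by index reversal and using skew
   centrosymmetry gives [A (Jx)^(m-1) = - J (A x^(m-1))]; entrywise powers
   commute with [J], and [J] is an involution, so [Jx] is nonzero. *)
Require Import Defs.
From HB Require Import structures.
From mathcomp Require Import all_boot all_order all_algebra.
From mathcomp Require Import reals.

Set Implicit Arguments.
Unset Strict Implicit.
Unset Printing Implicit Defensive.

Import Order.TTheory GRing.Theory Num.Theory.
Local Open Scope ring_scope.

Lemma mul_exchange_mxE (R : realType) (n : nat) (x : 'cV[R]_n) (i : 'I_n) (j : 'I_1) :
  (exchange_mx R n *m x) i j = x (rev_ord i) j.
Proof.
rewrite mxE (bigD1 (rev_ord i)) //= mxE rev_ordK eqxx mul1r big1 ?addr0 // => k.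
(* Since [rev_ord] is an involution, the test [i == rev_ord k] amounts to [k == rev_ord i], which
   fails off the extracted term. *)
by rewrite mxE eq_sym (can2_eq (@rev_ordK _) (@rev_ordK _)) => /negPf->; rewrite mul0r.
Qed.

Lemma exchange_mxK (R : realType) (n : nat) (x : 'cV[R]_n) :
  exchange_mx R n *m (exchange_mx R n *m x) = x.
Proof. by apply/matrixP => i j; rewrite !mul_exchange_mxE rev_ordK. Qed.

Lemma vec_pow_exchange (R : realType) (n : nat) (x : 'cV[R]_n) (k : nat) :
  vec_pow (exchange_mx R n *m x) k = exchange_mx R n *m vec_pow x k.
Proof. by apply/matrixP => i j; rewrite mul_exchange_mxE [RHS]mxE [LHS]mxE mul_exchange_mxE. Qed.

Lemma tensor_app_exchange (R : realType) (m n : nat) (A : tensor R m.+1 n)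
    (x : 'cV[R]_n) : skew_centrosymmetric A ->
  tensor_app A (exchange_mx R n *m x) = - (exchange_mx R n *m tensor_app A x).
Proof.
move=> skewA; apply/matrixP => i j; rewrite [RHS]mxE mul_exchange_mxE !mxE -sumrN.
(* The reversal acts on the value of each index; positions in the tuple stay fixed. *)
have revK : involutive (fun t : m.-tuple 'I_n => [tuple of map (@rev_ord n) t]).
  by move=> t; apply: val_inj; rewrite /= mapK //; exact: rev_ordK.
rewrite (reindex_inj (inv_inj revK)) /=; apply: eq_bigr => t _.
(* Skewness reverses all [m.+1] indices: the leading [i] becomes [rev_ord i], while the tail,
   already reversed by the reindexing, returns to [t]. *)
rewrite skewA mulNr; congr (- (A _ * _)).
  by apply: val_inj; rewrite /= mapK //; exact: rev_ordK.
(* In each factor the reversal from [exchange_mx] cancels the one from the reindexing. *)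
by apply: eq_bigr => k _; rewrite mul_exchange_mxE tnth_map rev_ordK.
Qed.

Theorem theorem4p4 (R : realType) (m n : nat) (n_gt0 : (0 < n)%N)
    (A : tensor R m.+1 n) (skewA : skew_centrosymmetric A)
    (lambda : R) (lambda_neq0 : lambda != 0)
    (x : 'cV[R]_n) (Ax : H_eigenpair A lambda x) :
  H_eigenpair A (- lambda) (exchange_mx R n *m x).
Proof.
case: Ax => x_neq0 Ax; split.
  by apply: contra_neq x_neq0 => Jx0; rewrite -[x]exchange_mxK Jx0 mulmx0.
by rewrite tensor_app_exchange // Ax vec_pow_exchange scaleNr scalemxAr.
Qed.
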